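(* Let $\Sigma$ be a non-developable ruled Ricci surface in $\mathbb{R}^3$ which can be parametrized so that its line of striction is contained in a straight line. Then $\Sigma$ is a piece of helicoid.
   Context: $I,J\subset\mathbb{R}$ are open intervals and all curves and maps are smooth; $\wedge$ is the cross product. Ruled surfaces are assumed non-cylindrical and parametrized as follows: a ruled surface $\Sigma$ is a surface parametrized by an immersion $X:I\times J\to\mathbb{R}^3$, $X(t,u)=\alpha(t)+u\beta(t)$, with $\alpha:I\to\mathbb{R}^3$ and $\beta:I\to\mathbb{S}^2$ satisfying $\|\beta(t)\|=\|\beta'(t)\|=1$ and $\langle\alpha'(t),\beta'(t)\rangle=0$ for all $t\in I$. The curve $\alpha$ (not assumed regular) is then called the line of striction. There is a unique function $\lambda:I\to\mathbb{R}$ with $\alpha'\wedge\beta=\lambda\beta'$, called the distribution parameter; $\Sigma$ is non-developable if $\lambda$ does not vanish identically. ''Can be parametrized so that its line of striction is contained in a straight line'' means that there is such a parametrization for which $\alpha(I)$ is contained in a straight line. A ruled Ricci surface is a ruled surface in $\mathbb{R}^3$ whose induced metric satisfies the Ricci condition $K\Delta K - \|\nabla K\|^2 - 4K^3 = 0$, where $K$ is the Gauss curvature, $\nabla$ the gradient and $\Delta=\mathrm{div}\,\nabla$ the Laplace–Beltrami operator of the induced metric. A piece of helicoid is, up to a rigid motion (isometry) of $\mathbb{R}^3$, a surface parametrized by $(t,u)\mapsto(0,0,at+b)+u(\cos t,\sin t,0)$, $(t,u)\in I\times J$, for constants $a\neq0$ and $b$. *)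

(* Defs.v *)
From Stdlib Require Import Reals.
From Coquelicot Require Import Coquelicot.
Open Scope R_scope.

(* Sums and scalar multiples in [R3] are Coquelicot's [plus], [minus], [scal],
   which act coordinatewise on products. *)
Definition R3 : Type := (R * R * R)%type.

Definition mk3 (x y z : R) : R3 := (x, y, z).
Definition cx (p : R3) : R := fst (fst p).
Definition cy (p : R3) : R := snd (fst p).
Definition cz (p : R3) : R := snd p.

Definition dot (p q : R3) : R := cx p * cx q + cy p * cy q + cz p * cz q.

Definition cross (p q : R3) : R3 :=
  mk3 (cy p * cz q - cz p * cy q)
      (cz p * cx q - cx p * cz q)
      (cx p * cy q - cy p * cx q).

Definition enorm (p : R3) : R := sqrt (dot p p).

Definition isometry (M : R3 -> R3) : Prop :=
  forall p q : R3, enorm (minus (M p) (M q)) = enorm (minus p q).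

(* Nonempty, possibly unbounded. *)
Definition open_interval (A : R -> Prop) : Prop :=
  exists a b : Rbar, Rbar_lt a b /\
    forall x : R, A x <-> Rbar_lt a x /\ Rbar_lt x b.

(* Functions are total; only their values on the relevant open intervals
   matter, since derivatives at a point of an open set are local. *)
Definition smooth_on (A : R -> Prop) (c : R -> R3) : Prop :=
  forall (n : nat) (t : R), A t ->
    ex_derive_n (fun s => cx (c s)) n t /\
    ex_derive_n (fun s => cy (c s)) n t /\
    ex_derive_n (fun s => cz (c s)) n t.

Definition velocity (c : R -> R3) (t : R) : R3 :=
  mk3 (Derive (fun s => cx (c s)) t)
      (Derive (fun s => cy (c s)) t)
      (Derive (fun s => cz (c s)) t).

Definition pd1 (f : R -> R -> R) (t u : R) : R := Derive (fun s => f s u) t.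
Definition pd2 (f : R -> R -> R) (t u : R) : R := Derive (fun v => f t v) u.

Definition vpd1 (X : R -> R -> R3) (t u : R) : R3 := velocity (fun s => X s u) t.
Definition vpd2 (X : R -> R -> R3) (t u : R) : R3 := velocity (fun v => X t v) u.

Definition regular_on (I J : R -> Prop) (X : R -> R -> R3) : Prop :=
  forall t u : R, I t -> J u -> forall a b : R,
    plus (scal a (vpd1 X t u)) (scal b (vpd2 X t u)) = zero -> a = 0 /\ b = 0.

Definition parametrized_by
    (Sigma : R3 -> Prop) (I J : R -> Prop) (X : R -> R -> R3) : Prop :=
  forall p : R3, Sigma p <-> exists t u : R, I t /\ J u /\ p = X t u.

Section FundamentalForms.
Variable X : R -> R -> R3.

Definition gE (t u : R) : R := dot (vpd1 X t u) (vpd1 X t u).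
Definition gF (t u : R) : R := dot (vpd1 X t u) (vpd2 X t u).
Definition gG (t u : R) : R := dot (vpd2 X t u) (vpd2 X t u).
Definition gdet (t u : R) : R := gE t u * gG t u - gF t u * gF t u.

Definition unit_normal (t u : R) : R3 :=
  let N := cross (vpd1 X t u) (vpd2 X t u) in scal (/ enorm N) N.

Definition hL (t u : R) : R := dot (vpd1 (vpd1 X) t u) (unit_normal t u).
Definition hM (t u : R) : R := dot (vpd1 (vpd2 X) t u) (unit_normal t u).
Definition hN (t u : R) : R := dot (vpd2 (vpd2 X) t u) (unit_normal t u).

Definition gauss_curvature (t u : R) : R :=
  (hL t u * hN t u - hM t u * hM t u) / gdet t u.

(* A tangent field [V1 d/dt + V2 d/du] is given by its components [V1], [V2];
   [grad1], [grad2] are the components of the inverse of the matrix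
   [[gE, gF], [gF, gG]] applied to the differential of [f]. *)
Definition grad1 (f : R -> R -> R) (t u : R) : R :=
  (gG t u * pd1 f t u - gF t u * pd2 f t u) / gdet t u.
Definition grad2 (f : R -> R -> R) (t u : R) : R :=
  (gE t u * pd2 f t u - gF t u * pd1 f t u) / gdet t u.

Definition metric_sqnorm (V1 V2 : R -> R -> R) (t u : R) : R :=
  gE t u * V1 t u * V1 t u + 2 * gF t u * V1 t u * V2 t u
  + gG t u * V2 t u * V2 t u.

Definition divergence (V1 V2 : R -> R -> R) (t u : R) : R :=
  (pd1 (fun s v => sqrt (gdet s v) * V1 s v) t u
   + pd2 (fun s v => sqrt (gdet s v) * V2 s v) t u) / sqrt (gdet t u).

Definition laplace_beltrami (f : R -> R -> R) : R -> R -> R :=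
  divergence (grad1 f) (grad2 f).

Definition ricci_condition (I J : R -> Prop) : Prop :=
  forall t u : R, I t -> J u ->
    gauss_curvature t u * laplace_beltrami gauss_curvature t u
    - metric_sqnorm (grad1 gauss_curvature) (grad2 gauss_curvature) t u
    - 4 * gauss_curvature t u ^ 3 = 0.

End FundamentalForms.

Definition ruled (alpha beta : R -> R3) (t u : R) : R3 :=
  plus (alpha t) (scal u (beta t)).

Definition ruled_parametrization
    (I J : R -> Prop) (alpha beta : R -> R3) : Prop :=
  open_interval I /\ open_interval J /\
  smooth_on I alpha /\ smooth_on I beta /\
  (forall t : R, I t ->
     enorm (beta t) = 1 /\ enorm (velocity beta t) = 1 /\
     dot (velocity alpha t) (velocity beta t) = 0) /\
  regular_on I J (ruled alpha beta).

Definition distribution_parameter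
    (I : R -> Prop) (alpha beta : R -> R3) (lambda : R -> R) : Prop :=
  forall t : R, I t ->
    cross (velocity alpha t) (beta t) = scal (lambda t) (velocity beta t).

(* [lambda] is unique on [I], as [velocity beta] does not vanish there. *)
Definition non_developable (I : R -> Prop) (alpha beta : R -> R3) : Prop :=
  exists lambda : R -> R,
    distribution_parameter I alpha beta lambda /\
    exists t : R, I t /\ lambda t <> 0.

Definition contained_in_line (I : R -> Prop) (c : R -> R3) : Prop :=
  exists p v : R3, v <> zero /\
    forall t : R, I t -> exists s : R, c t = plus p (scal s v).

Definition helicoid (a b t u : R) : R3 :=
  plus (mk3 0 0 (a * t + b)) (scal u (mk3 (cos t) (sin t) 0)).

Definition piece_of_helicoid (Sigma : R3 -> Prop) : Prop :=
  exists (M : R3 -> R3) (a b : R) (I J : R -> Prop),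
    isometry M /\ a <> 0 /\ open_interval I /\ open_interval J /\
    parametrized_by Sigma I J (fun t u => M (helicoid a b t u)).

(* Main.v *)
From Stdlib Require Import Reals Lra.
From Coquelicot Require Import Coquelicot.
(* Imported last: [open_interval] is also the name of a notion of the
   standard library. *)
Require Import Defs.
Open Scope R_scope.

(** Write c for the velocity of the director curve beta, n = beta x c,
    l for the distribution parameter and m = <alpha', beta>. The frame
    (beta, c, n) is orthonormal and alpha' = m beta + l n, so that, in the
    coordinates (t, u),
      E = m^2 + l^2 + u^2,  F = m,  G = 1,  K = - l^2 / (l^2 + u^2)^2
    ([ruled_striction_metric]). Thus only l and m enter the Ricci condition,
    and where l does not vanish its left-hand side is a nonvanishing factor
    times a quartic polynomial in u whose coefficients involve l, l', l'', m
    and m' ([ricci_expression]). This quartic vanishes on an open interval,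
    hence identically, and its coefficients of degree 1, 2 and 3 alone force
    l' = 0 and m = 0 ([ricci_coefficients]). So (l^2)' = 2 l l' vanishes on
    all of I, wherever l vanishes or not, and l is a nonzero constant a while
    m = 0 ([ricci_ruled_rigidity]).

    Now alpha' = a n. If alpha stays in a line of direction v, then n is
    parallel to v, so v is orthogonal to beta and to c, and, by
    differentiation, to beta''. Since beta'' + beta is orthogonal to beta and
    c in any case, it vanishes ([director_great_circle]): beta describes a
    great circle at unit speed, n is constant and alpha moves along n with
    velocity a, which is a helicoid ([piece_of_helicoid_of_great_circle]). *)

(** * Real functions on open intervals *)

Lemma open_interval_open (A : R -> Prop) : open_interval A -> open A.
Proof.
  intros (a & b & _ & HA).
  apply (open_ext (fun x : R => Rbar_lt a x /\ Rbar_lt x b)).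
  - intros x; symmetry; apply HA.
  - apply open_and; [apply open_Rbar_gt | apply open_Rbar_lt].
Qed.

Lemma open_interval_convex (A : R -> Prop) (x y z : R) :
  open_interval A -> A x -> A y -> x <= z <= y -> A z.
Proof.
  intros (a & b & _ & HA) Hx Hy Hz.
  apply HA in Hx; apply HA in Hy; apply HA; split.
  - apply Rbar_lt_le_trans with x; [apply Hx | apply Hz].
  - apply Rbar_le_lt_trans with y; [apply Hz | apply Hy].
Qed.

Lemma open_interval_inhabited (A : R -> Prop) :
  open_interval A -> exists x : R, A x.
Proof.
  intros (a & b & Hab & HA).
  enough (H : exists x : R, Rbar_lt a x /\ Rbar_lt x b)
    by (destruct H as [x Hx]; exists x; apply HA, Hx).
  destruct a as [a| |], b as [b| |]; simpl in *; try easy.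
  - exists ((a + b) / 2); lra.
  - exists (a + 1); lra.
  - exists (b - 1); lra.
  - now exists 0.
Qed.

Lemma is_derive_ext_on (A : R -> Prop) (f g : R -> R) (t l : R) :
  open A -> (forall s, A s -> f s = g s) -> A t ->
  is_derive f t l -> is_derive g t l.
Proof.
  intros HA H Ht; apply is_derive_ext_loc.
  apply (filter_imp A); [exact H | exact (HA t Ht)].
Qed.

Lemma Derive_eq_on (A : R -> Prop) (f g : R -> R) (t l : R) :
  open A -> (forall s, A s -> f s = g s) -> A t ->
  is_derive g t l -> Derive f t = l.
Proof.
  intros HA H Ht Hg; apply is_derive_unique.
  apply (is_derive_ext_on A g); auto; intros; symmetry; auto.
Qed.

Lemma derive_constant_on (A : R -> Prop) (f : R -> R) (c t l : R) :
  open A -> (forall s, A s -> f s = c) -> A t -> is_derive f t l -> l = 0.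
Proof.
  intros HA H Ht Hf.
  rewrite <- (is_derive_unique _ _ _ Hf).
  apply (Derive_eq_on A _ (fun _ => c)); auto.
  exact (is_derive_const c t).
Qed.

Lemma constant_of_derive_zero (A : R -> Prop) (f : R -> R) (x y : R) :
  open_interval A -> (forall t, A t -> is_derive f t 0) ->
  A x -> A y -> f x = f y.
Proof.
  intros HA Hf.
  assert (H : forall x y, A x -> A y -> x < y -> f x = f y).
  { intros a b Ha Hb Hab; apply (eq_is_derive f a b); [|exact Hab].
    intros t Ht; apply Hf, (open_interval_convex A a b); auto. }
  intros Hx Hy; destruct (Rtotal_order x y) as [Hxy|[->|Hxy]]; auto.
  symmetry; auto.
Qed.

(** * Curves in space *)

(** Unlike [velocity], this asserts differentiability. *)
Definition is_velocity (c : R -> R3) (t : R) (w : R3) : Prop :=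
  is_derive (fun s : R => cx (c s)) t (cx w) /\
  is_derive (fun s : R => cy (c s)) t (cy w) /\
  is_derive (fun s : R => cz (c s)) t (cz w).

Lemma is_velocity_eq (c : R -> R3) (t : R) (w w' : R3) :
  is_velocity c t w -> w = w' -> is_velocity c t w'.
Proof. now intros H <-. Qed.

Lemma velocity_unique (c : R -> R3) (t : R) (w : R3) :
  is_velocity c t w -> velocity c t = w.
Proof.
  intros (Hx & Hy & Hz); unfold velocity.
  apply is_derive_unique in Hx, Hy, Hz; rewrite Hx, Hy, Hz.
  now destruct w as [[? ?] ?].
Qed.

Lemma smooth_is_velocity (A : R -> Prop) (c : R -> R3) (t : R) :
  smooth_on A c -> A t -> is_velocity c t (velocity c t).
Proof.
  intros Hc Ht; destruct (Hc 1%nat t Ht) as (Hx & Hy & Hz).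
  split; [|split]; apply Derive_correct; assumption.
Qed.

Lemma ex_derive_n_Derive (f : R -> R) (n : nat) (t : R) :
  ex_derive_n f (S n) t -> ex_derive_n (Derive f) n t.
Proof.
  destruct n as [|n]; [easy|]; simpl.
  apply ex_derive_ext; intros s.
  transitivity (Derive_n f (n + 1) s).
  - now rewrite Nat.add_1_r.
  - symmetry; exact (Derive_n_comp f n 1 s).
Qed.

Lemma smooth_velocity (A : R -> Prop) (c : R -> R3) :
  smooth_on A c -> smooth_on A (velocity c).
Proof.
  intros Hc n t Ht; destruct (Hc (S n) t Ht) as (Hx & Hy & Hz).
  now repeat split; apply ex_derive_n_Derive.
Qed.

(** The differentiation rules for real functions, in a form that unifies
    syntactically with the coordinates of a vector expression. *)
Lemma is_derive_mult_R (f g : R -> R) (t f' g' : R) :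
  is_derive f t f' -> is_derive g t g' ->
  is_derive (fun s : R => f s * g s) t (f' * g t + f t * g').
Proof. intros Hf Hg; apply (is_derive_mult f g); auto using Rmult_comm. Qed.

Lemma is_derive_eq (f : R -> R) (t l l' : R) :
  is_derive f t l -> l = l' -> is_derive f t l'.
Proof. now intros H <-. Qed.

Lemma is_derive_plus_R (f g : R -> R) (t f' g' : R) :
  is_derive f t f' -> is_derive g t g' ->
  is_derive (fun s : R => f s + g s) t (f' + g').
Proof. exact (is_derive_plus f g t f' g'). Qed.

Lemma is_derive_minus_R (f g : R -> R) (t f' g' : R) :
  is_derive f t f' -> is_derive g t g' ->
  is_derive (fun s : R => f s - g s) t (f' - g').
Proof. exact (is_derive_minus f g t f' g'). Qed.

Ltac derive_coordinates :=
  cbv [is_velocity dot cross mk3 cx cy cz plus scal fst snd] in *; simpl in *;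
  cbv [is_velocity dot cross mk3 cx cy cz plus scal fst snd mult] in *; simpl in *;
  eapply is_derive_eq;
  [ repeat first
      [ eassumption
      | simple apply is_derive_mult_R
      | simple apply is_derive_minus_R
      | simple apply is_derive_plus_R ]
  | try change (@mult R_AbsRing) with Rmult; ring ].

Lemma is_derive_dot (c d : R -> R3) (t : R) (c' d' : R3) :
  is_velocity c t c' -> is_velocity d t d' ->
  is_derive (fun s : R => dot (c s) (d s)) t (dot c' (d t) + dot (c t) d').
Proof.
  intros (Hx & Hy & Hz) (Kx & Ky & Kz); unfold dot; derive_coordinates.
Qed.

Lemma is_velocity_plus (c d : R -> R3) (t : R) (c' d' : R3) :
  is_velocity c t c' -> is_velocity d t d' ->
  is_velocity (fun s => plus (c s) (d s)) t (plus c' d').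
Proof.
  intros (Hx & Hy & Hz) (Kx & Ky & Kz).
  split; [|split]; apply is_derive_plus_R; assumption.
Qed.

Lemma is_velocity_cross (c d : R -> R3) (t : R) (c' d' : R3) :
  is_velocity c t c' -> is_velocity d t d' ->
  is_velocity (fun s => cross (c s) (d s)) t
    (plus (cross c' (d t)) (cross (c t) d')).
Proof.
  intros (Hx & Hy & Hz) (Kx & Ky & Kz); split; [|split]; derive_coordinates.
Qed.

Lemma is_velocity_combination (a b : R -> R) (c d : R -> R3) (t a' b' : R)
    (c' d' : R3) :
  is_derive a t a' -> is_derive b t b' ->
  is_velocity c t c' -> is_velocity d t d' ->
  is_velocity (fun s => plus (scal (a s) (c s)) (scal (b s) (d s))) t
   (plus (plus (scal a' (c t)) (scal (a t) c'))
         (plus (scal b' (d t)) (scal (b t) d'))).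
Proof.
  intros Ha Hb (Hx & Hy & Hz) (Kx & Ky & Kz); split; [|split]; derive_coordinates.
Qed.

Lemma constant_of_velocity_zero (A : R -> Prop) (c : R -> R3) (x y : R) :
  open_interval A -> (forall t, A t -> is_velocity c t (mk3 0 0 0)) ->
  A x -> A y -> c x = c y.
Proof.
  intros HA Hc Hx Hy.
  assert (Ex := constant_of_derive_zero A (fun s => cx (c s)) x y HA
    (fun t Ht => proj1 (Hc t Ht)) Hx Hy).
  assert (Ey := constant_of_derive_zero A (fun s => cy (c s)) x y HA
    (fun t Ht => proj1 (proj2 (Hc t Ht))) Hx Hy).
  assert (Ez := constant_of_derive_zero A (fun s => cz (c s)) x y HA
    (fun t Ht => proj2 (proj2 (Hc t Ht))) Hx Hy).
  simpl in *; destruct (c x) as [[? ?] ?], (c y) as [[? ?] ?].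
  cbv [cx cy cz fst snd] in *; congruence.
Qed.

Lemma is_velocity_ext_on (A : R -> Prop) (c d : R -> R3) (t : R) (w : R3) :
  open A -> (forall s, A s -> c s = d s) -> A t ->
  is_velocity c t w -> is_velocity d t w.
Proof.
  intros HA H Ht (Hx & Hy & Hz).
  split; [|split]; eapply (is_derive_ext_on A); eauto; intros s Hs; simpl;
    now rewrite H.
Qed.

Lemma is_velocity_const (p : R3) (t : R) : is_velocity (fun _ => p) t (mk3 0 0 0).
Proof. split; [|split]; apply @is_derive_const. Qed.

Lemma velocity_constant_on (A : R -> Prop) (c : R -> R3) (p : R3) (t : R) (w : R3) :
  open A -> (forall s, A s -> c s = p) -> A t -> is_velocity c t w -> w = mk3 0 0 0.
Proof.
  intros HA H Ht Hw.
  rewrite <- (velocity_unique _ _ _ Hw); apply velocity_unique.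
  apply (is_velocity_ext_on A (fun _ => p)); auto using is_velocity_const.
  intros; symmetry; auto.
Qed.

Lemma velocity_ext (c d : R -> R3) (t : R) :
  (forall s, c s = d s) -> velocity c t = velocity d t.
Proof.
  intros H; unfold velocity.
  f_equal; apply Derive_ext; intros; now rewrite H.
Qed.

(** * The Ricci condition for the metric of a ruled surface *)

Lemma Derive_sqrt_mult (g f : R -> R) (t g' f' : R) :
  is_derive g t g' -> 0 < g t -> is_derive f t f' ->
  Derive (fun s => sqrt (g s) * f s) t
  = sqrt (g t) * (f' + g' * f t / (2 * g t)).
Proof.
  intros Hg Hpos Hf.
  assert (Hs : 0 < sqrt (g t)) by now apply sqrt_lt_R0.
  apply is_derive_unique; eapply is_derive_eq.
  - apply is_derive_mult_R; [apply is_derive_sqrt|]; eassumption.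
  - assert (E : g t = sqrt (g t) * sqrt (g t)) by (symmetry; apply sqrt_sqrt; lra).
    set (r := sqrt (g t)) in *; rewrite E; field; lra.
Qed.

(** Differentiating the density by the product rule removes the square roots:
    the divergence becomes a rational expression. *)
Lemma divergence_eq (X : R -> R -> R3) (V1 V2 : R -> R -> R)
    (t u gt gu v1 v2 : R) :
  0 < gdet X t u ->
  is_derive (fun s : R => gdet X s u) t gt -> is_derive (fun v => gdet X t v) u gu ->
  is_derive (fun s : R => V1 s u) t v1 -> is_derive (fun v => V2 t v) u v2 ->
  divergence X V1 V2 t u
  = v1 + v2 + (gt * V1 t u + gu * V2 t u) / (2 * gdet X t u).
Proof.
  intros Hpos Hgt Hgu Hv1 Hv2; unfold divergence, pd1, pd2.
  rewrite (Derive_sqrt_mult (fun s => gdet X s u) (fun s => V1 s u) t gt v1),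
    (Derive_sqrt_mult (fun v => gdet X t v) (fun v => V2 t v) u gu v2); auto.
  assert (0 < sqrt (gdet X t u)) by now apply sqrt_lt_R0.
  field; lra.
Qed.

(** The curvature is recorded next to the metric, which determines it, because
    [gauss_curvature] is defined through the second fundamental form. *)
Definition has_striction_metric (X : R -> R -> R3) (A J : R -> Prop)
    (l m : R -> R) : Prop :=
  forall s v, A s -> J v ->
    gE X s v = m s ^ 2 + l s ^ 2 + v ^ 2 /\ gF X s v = m s /\ gG X s v = 1 /\
    gauss_curvature X s v = - l s ^ 2 / (l s ^ 2 + v ^ 2) ^ 2.

(** The polynomial factor has a short origin: away from the zeros of [l],
    the Ricci condition is [Delta (ln |K|) = 4 K]. With [D = l ^ 2 + u ^ 2],
    [h = ln |l| - ln D] and the field [T = d/dt - m d/du] orthogonal to the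
    rulings, the part of [Delta h] along the rulings is exactly [2 K], so that
    [T (T h / sqrt D) = 0] remains. Clearing denominators gives the quartic. *)
Lemma ricci_expression (X : R -> R -> R3) (A J : R -> Prop)
    (l l1 m : R -> R) (t u l2 m1 : R) :
  open A -> open J -> has_striction_metric X A J l m ->
  (forall s, A s -> l s <> 0) ->
  (forall s, A s -> is_derive l s (l1 s)) ->
  is_derive l1 t l2 -> is_derive m t m1 -> A t -> J u ->
  let K := gauss_curvature X in
  K t u * laplace_beltrami X K t u
  - metric_sqnorm X (grad1 X K) (grad2 X K) t u - 4 * K t u ^ 3
  = 2 * l t ^ 2 / (l t ^ 2 + u ^ 2) ^ 7 *
    ((l t * l2 - l1 t ^ 2) * u ^ 4
     + (2 * l t ^ 2 * m1 + l t * l1 t * m t) * u ^ 3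
     + l t ^ 2 * (4 * m t ^ 2 - 5 * l1 t ^ 2) * u ^ 2
     + (2 * l t ^ 4 * m1 - 11 * l t ^ 3 * l1 t * m t) * u
     + l t ^ 4 * (2 * l1 t ^ 2 - 2 * m t ^ 2 - l t * l2)).
Proof.
  intros HA HJ HX Hnz Hl Hl1 Hm Ht Hu K.
  assert (Dl : forall s, A s -> Derive (fun x => l x) s = l1 s)
    by (intros; now apply is_derive_unique, Hl).
  assert (Dl1 : Derive (fun x => l1 x) t = l2) by now apply is_derive_unique.
  assert (Dm : Derive (fun x => m x) t = m1) by now apply is_derive_unique.
  assert (Hpos : forall s v, A s -> 0 < l s ^ 2 + v ^ 2).
  { intros s v Hs; generalize (Hnz s Hs); intros; nra. }
  assert (Hg : forall s v, A s -> J v -> gdet X s v = l s ^ 2 + v ^ 2).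
  { intros s v Hs Hv; destruct (HX s v Hs Hv) as (E & F & G & _).
    unfold gdet; rewrite E, F, G; ring. }
  assert (K1 : forall s v, A s -> J v -> pd1 K s v
     = 2 * l s * l1 s * (l s ^ 2 - v ^ 2) / (l s ^ 2 + v ^ 2) ^ 3).
  { intros s v Hs Hv.
    apply (Derive_eq_on A _ (fun s => - l s ^ 2 / (l s ^ 2 + v ^ 2) ^ 2)); auto.
    - intros r Hr; apply HX; auto.
    - specialize (Hpos s v Hs); auto_derive.
      + repeat split; try (eexists; eauto; fail).
        intro E; assert (0 < (l s ^ 2 + v ^ 2) ^ 2) by (apply pow_lt; auto).
        simpl in *; lra.
      + rewrite (Dl s Hs); field; simpl in *; lra. }
  assert (K2 : forall s v, A s -> J v -> pd2 K s v
     = 4 * v * l s ^ 2 / (l s ^ 2 + v ^ 2) ^ 3).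
  { intros s v Hs Hv.
    apply (Derive_eq_on J _ (fun v => - l s ^ 2 / (l s ^ 2 + v ^ 2) ^ 2)); auto.
    - intros r Hr; apply HX; auto.
    - specialize (Hpos s v Hs); auto_derive.
      + intro E; assert (0 < (l s ^ 2 + v ^ 2) ^ 2) by (apply pow_lt; auto).
        simpl in *; lra.
      + field; simpl in *; lra. }
  assert (G1 : forall s v, A s -> J v -> grad1 X K s v
     = 2 * l s * (l1 s * (l s ^ 2 - v ^ 2) - 2 * m s * l s * v)
       / (l s ^ 2 + v ^ 2) ^ 4).
  { intros s v Hs Hv; unfold grad1.
    rewrite K1, K2, Hg by auto; destruct (HX s v Hs Hv) as (E & F & G & _).
    rewrite F, G; field; specialize (Hpos s v Hs); simpl in *; lra. }
  assert (G2 : forall s v, A s -> J v -> grad2 X K s v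
     = 4 * v * l s ^ 2 / (l s ^ 2 + v ^ 2) ^ 3
       - m s * (2 * l s * (l1 s * (l s ^ 2 - v ^ 2) - 2 * m s * l s * v)
       / (l s ^ 2 + v ^ 2) ^ 4)).
  { intros s v Hs Hv; unfold grad2.
    rewrite K1, K2, Hg by auto; destruct (HX s v Hs Hv) as (E & F & G & _).
    rewrite E, F; field; specialize (Hpos s v Hs); simpl in *; lra. }
  assert (Hpos4 : forall s v, A s -> 0 < (l s ^ 2 + v ^ 2) ^ 4)
    by (intros; apply pow_lt; auto).
  assert (Hpos3 : forall s v, A s -> 0 < (l s ^ 2 + v ^ 2) ^ 3)
    by (intros; apply pow_lt; auto).
  unfold laplace_beltrami.
  erewrite divergence_eq; cycle 1.
  - rewrite Hg by auto; auto.
  - apply (is_derive_ext_on A (fun s => l s ^ 2 + u ^ 2)); auto.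
    + intros; symmetry; apply Hg; auto.
    + auto_derive; [eexists; auto|].
      rewrite (Dl t Ht); reflexivity.
  - apply (is_derive_ext_on J (fun v => l t ^ 2 + v ^ 2)); auto.
    + intros; symmetry; apply Hg; auto.
    + auto_derive; [easy|]. reflexivity.
  - apply (is_derive_ext_on A (fun s =>
       2 * l s * (l1 s * (l s ^ 2 - u ^ 2) - 2 * m s * l s * u)
       / (l s ^ 2 + u ^ 2) ^ 4)); auto.
    + intros; symmetry; apply G1; auto.
    + auto_derive.
      * repeat split; try (eexists; eauto; fail).
        specialize (Hpos4 t u Ht); simpl in *; lra.
      * rewrite (Dl t Ht), Dl1, Dm; reflexivity.
  - apply (is_derive_ext_on J (fun v =>
        4 * v * l t ^ 2 / (l t ^ 2 + v ^ 2) ^ 3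
       - m t * (2 * l t * (l1 t * (l t ^ 2 - v ^ 2) - 2 * m t * l t * v)
       / (l t ^ 2 + v ^ 2) ^ 4))); auto.
    + intros; symmetry; apply G2; auto.
    + auto_derive.
      * specialize (Hpos4 t u Ht); specialize (Hpos3 t u Ht); simpl in *; lra.
      * reflexivity.
  - unfold metric_sqnorm; rewrite G1, G2, Hg by auto; unfold K.
    destruct (HX t u Ht Hu) as (E & F & G & ->); rewrite E, F, G.
    specialize (Hpos t u Ht); field; simpl in *; lra.
Qed.

(** Each derivative of the polynomial vanishes on [J] too; the coefficients
    are read off from the last derivative backwards. *)
Lemma quartic_zero_on (J : R -> Prop) (c4 c3 c2 c1 c0 : R) :
  open J -> (exists u, J u) ->
  (forall u, J u -> c4 * u ^ 4 + c3 * u ^ 3 + c2 * u ^ 2 + c1 * u + c0 = 0) ->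
  c4 = 0 /\ c3 = 0 /\ c2 = 0 /\ c1 = 0 /\ c0 = 0.
Proof.
  intros HJ [u Hu] H0.
  assert (H1 : forall u, J u ->
    4 * c4 * u ^ 3 + 3 * c3 * u ^ 2 + 2 * c2 * u + c1 = 0).
  { intros v Hv; apply (derive_constant_on J _ 0 v _ HJ H0 Hv).
    auto_derive; [easy | ring]. }
  assert (H2 : forall u, J u -> 12 * c4 * u ^ 2 + 6 * c3 * u + 2 * c2 = 0).
  { intros v Hv; apply (derive_constant_on J _ 0 v _ HJ H1 Hv).
    auto_derive; [easy | ring]. }
  assert (H3 : forall u, J u -> 24 * c4 * u + 6 * c3 = 0).
  { intros v Hv; apply (derive_constant_on J _ 0 v _ HJ H2 Hv).
    auto_derive; [easy | ring]. }
  assert (H4 : 24 * c4 = 0).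
  { apply (derive_constant_on J _ 0 u _ HJ H3 Hu).
    auto_derive; [easy | ring]. }
  specialize (H0 u Hu); specialize (H1 u Hu); specialize (H2 u Hu);
    specialize (H3 u Hu).
  assert (E4 : c4 = 0) by lra; subst c4.
  assert (E3 : c3 = 0) by lra; subst c3.
  assert (E2 : c2 = 0) by lra; subst c2.
  assert (E1 : c1 = 0) by lra; subst c1.
  repeat split; lra.
Qed.

(** Up to powers of [l], the coefficients of degree 3 and 1 are
    [2 l m1 + l1 m] and [2 l m1 - 11 l1 m]; hence [l1 m = 0], and the
    coefficient of degree 2 then kills both factors. *)
Lemma ricci_coefficients (l l1 m m1 : R) :
  l <> 0 ->
  2 * l ^ 2 * m1 + l * l1 * m = 0 ->
  l ^ 2 * (4 * m ^ 2 - 5 * l1 ^ 2) = 0 ->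
  2 * l ^ 4 * m1 - 11 * l ^ 3 * l1 * m = 0 ->
  l1 = 0 /\ m = 0.
Proof.
  intros Hl H3 H2 H1.
  assert (Hp : l1 * m = 0).
  { apply (Rmult_eq_reg_l (12 * l ^ 3)).
    - transitivity (l ^ 2 * (2 * l ^ 2 * m1 + l * l1 * m)
        - (2 * l ^ 4 * m1 - 11 * l ^ 3 * l1 * m)); [ring|].
      rewrite H3, H1; ring.
    - apply Rmult_integral_contrapositive; split; [lra | now apply pow_nonzero]. }
  assert (Hs : 4 * m ^ 2 - 5 * l1 ^ 2 = 0).
  { apply Rmult_integral in H2 as [H2|H2]; [|exact H2].
    now apply (pow_nonzero l 2) in H2. }
  apply Rmult_integral in Hp as [->| ->]; split; nra.
Qed.

(** * Vector algebra *)

Lemma plus_R3 (p q : R3) :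
  plus p q = mk3 (cx p + cx q) (cy p + cy q) (cz p + cz q).
Proof. reflexivity. Qed.

Lemma minus_R3 (p q : R3) :
  minus p q = mk3 (cx p - cx q) (cy p - cy q) (cz p - cz q).
Proof. reflexivity. Qed.

Lemma scal_R3 (a : R) (p : R3) : scal a p = mk3 (a * cx p) (a * cy p) (a * cz p).
Proof. reflexivity. Qed.

Ltac vector_ring :=
  intros; repeat match goal with p : R3 |- _ => destruct p as [[? ?] ?] end;
  rewrite ?plus_R3, ?minus_R3, ?scal_R3;
  cbv [dot cross mk3 cx cy cz fst snd];
  first [ring | f_equal; [f_equal|]; ring].

Lemma dot_comm (p q : R3) : dot p q = dot q p.
Proof. vector_ring. Qed.

Lemma dot_combination (a b : R) (p q r : R3) :
  dot (plus (scal a p) (scal b q)) r = a * dot p r + b * dot q r.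
Proof. vector_ring. Qed.

Lemma dot_plus (p q r : R3) : dot (plus p q) r = dot p r + dot q r.
Proof. vector_ring. Qed.

Lemma dot_scal (a : R) (p q : R3) : dot (scal a p) q = a * dot p q.
Proof. vector_ring. Qed.

Lemma dot_cross_cross (p q : R3) :
  dot (cross p q) (cross p q) = dot p p * dot q q - dot p q ^ 2.
Proof. vector_ring. Qed.

Lemma cross_cross (p q r : R3) :
  cross p (cross q r) = minus (scal (dot p r) q) (scal (dot p q) r).
Proof. vector_ring. Qed.

Lemma enorm_eq_1 (p : R3) : enorm p = 1 -> dot p p = 1.
Proof.
  unfold enorm; intros H; rewrite <- (sqrt_sqrt (dot p p)), H; [ring|].
  unfold dot; nra.
Qed.

(** [w] has zero cross product with the unit normal [cross b c], and the
    double cross product formula turns this into the stated equality. *)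
Lemma orthogonal_to_plane (b c w : R3) :
  dot b b = 1 -> dot c c = 1 -> dot b c = 0 -> dot w b = 0 -> dot w c = 0 ->
  w = scal (dot w (cross b c)) (cross b c).
Proof.
  intros Hb Hc Hbc Hwb Hwc.
  assert (Hn : dot (cross b c) (cross b c) = 1)
    by (rewrite dot_cross_cross, Hb, Hc, Hbc; ring).
  assert (Hz : cross w (cross b c) = mk3 0 0 0)
    by (rewrite cross_cross, Hwb, Hwc; vector_ring).
  assert (E : minus (scal (dot (cross b c) (cross b c)) w)
                (scal (dot (cross b c) w) (cross b c)) = mk3 0 0 0)
    by (rewrite <- cross_cross, Hz; vector_ring).
  rewrite Hn, (dot_comm _ w) in E; set (n := cross b c) in *.
  transitivity (plus (minus (scal 1 w) (scal (dot w n) n)) (scal (dot w n) n)).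
  - vector_ring.
  - rewrite E; clearbody n; vector_ring.
Qed.

(** * The metric of a ruled surface in striction parameters *)

Lemma vpd1_ruled (A : R -> Prop) (alpha beta : R -> R3) (t u : R) :
  smooth_on A alpha -> smooth_on A beta -> A t ->
  vpd1 (ruled alpha beta) t u
  = plus (velocity alpha t) (scal u (velocity beta t)).
Proof.
  intros Ha Hb Ht; apply velocity_unique.
  destruct (smooth_is_velocity A alpha t Ha Ht) as (Ax & Ay & Az).
  destruct (smooth_is_velocity A beta t Hb Ht) as (Bx & By & Bz).
  split; [|split]; apply is_derive_plus_R; try assumption;
    apply (is_derive_scal (fun s : R => _)); assumption.
Qed.

Lemma vpd2_ruled (alpha beta : R -> R3) (t u : R) :
  vpd2 (ruled alpha beta) t u = beta t.
Proof.
  apply velocity_unique; unfold ruled.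
  split; [|split]; rewrite ?plus_R3, ?scal_R3;
  cbn; auto_derive; try easy; unfold cx, cy, cz; simpl; ring.
Qed.

(** The rulings are straight, so [hN = 0] and only [hM] enters the curvature;
    [hM] comes from [<c, N> = <cross a b, c> = l], where [a], [b], [c] are
    [alpha'], [beta], [beta'] and [N] is the unnormalized normal. The square
    of [l] enters [gE] through Lagrange's identity for [cross a b]. *)
Lemma ruled_striction_metric (A J : R -> Prop) (alpha beta : R -> R3) (l : R -> R) :
  smooth_on A alpha -> smooth_on A beta ->
  (forall t, A t -> dot (beta t) (beta t) = 1 /\
     dot (velocity beta t) (velocity beta t) = 1 /\
     dot (velocity alpha t) (velocity beta t) = 0 /\
     dot (beta t) (velocity beta t) = 0) ->
  distribution_parameter A alpha beta l -> (forall t, A t -> l t <> 0) ->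
  has_striction_metric (ruled alpha beta) A J l
    (fun t => dot (velocity alpha t) (beta t)).
Proof.
  intros Ha Hb Hon Hl Hnz t u Ht _.
  destruct (Hon t Ht) as (Hbb & Hcc & Hac & Hbc).
  specialize (Hl t Ht); specialize (Hnz t Ht).
  assert (X1 := vpd1_ruled A alpha beta t u Ha Hb Ht).
  assert (X2 := vpd2_ruled alpha beta t u).
  assert (X12 : vpd1 (vpd2 (ruled alpha beta)) t u = velocity beta t)
    by (apply velocity_ext; intros; apply vpd2_ruled).
  assert (X22 : vpd2 (vpd2 (ruled alpha beta)) t u = mk3 0 0 0).
  { transitivity (velocity (fun _ => beta t) u).
    - apply velocity_ext; intros; apply vpd2_ruled.
    - apply velocity_unique, is_velocity_const. }
  revert X1 X2 X12 X22 Hbb Hcc Hac Hbc Hl.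
  generalize (velocity alpha t) (beta t) (velocity beta t); intros a b c.
  intros X1 X2 X12 X22 Hbb Hcc Hac Hbc Hl.
  assert (Haa : dot a a = dot a b ^ 2 + l t ^ 2).
  { assert (E := dot_cross_cross a b).
    rewrite Hl, dot_scal, dot_comm, dot_scal, Hcc, Hbb in E; lra. }
  assert (HE : gE (ruled alpha beta) t u = dot a b ^ 2 + l t ^ 2 + u ^ 2).
  { unfold gE; rewrite X1, dot_plus, dot_scal, !(dot_comm _ (plus _ _)),
      !dot_plus, !dot_scal, Hcc, Haa, (dot_comm c a), Hac; ring. }
  assert (HF : gF (ruled alpha beta) t u = dot a b).
  { unfold gF; rewrite X1, X2, dot_plus, dot_scal, (dot_comm c b), Hbc; ring. }
  assert (HG : gG (ruled alpha beta) t u = 1) by (unfold gG; now rewrite X2).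
  assert (Hdet : gdet (ruled alpha beta) t u = l t ^ 2 + u ^ 2)
    by (unfold gdet; rewrite HE, HF, HG; ring).
  repeat split; auto.
  unfold gauss_curvature; rewrite Hdet.
  assert (HN : hN (ruled alpha beta) t u = 0).
  { unfold hN; rewrite X22; unfold dot, mk3, cx, cy, cz; simpl; ring. }
  rewrite HN.
  set (N := cross (vpd1 (ruled alpha beta) t u) (vpd2 (ruled alpha beta) t u)).
  assert (HNN : dot N N = l t ^ 2 + u ^ 2).
  { unfold N; rewrite dot_cross_cross; fold (gE (ruled alpha beta) t u).
    fold (gF (ruled alpha beta) t u) (gG (ruled alpha beta) t u).
    rewrite <- Hdet; unfold gdet; ring. }
  assert (HcN : dot c N = l t).
  { unfold N; rewrite X1, X2.
    transitivity (dot (cross a b) c); [vector_ring|].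
    rewrite Hl, dot_scal, Hcc; ring. }
  assert (Hpos : 0 < l t ^ 2 + u ^ 2) by (simpl; nra).
  assert (HM : hM (ruled alpha beta) t u = l t / enorm N).
  { unfold hM, unit_normal; rewrite X12; fold N.
    rewrite dot_comm, dot_scal, dot_comm, HcN; unfold Rdiv; ring. }
  rewrite HM.
  assert (HnN : enorm N * enorm N = l t ^ 2 + u ^ 2)
    by (unfold enorm; rewrite HNN; apply sqrt_sqrt; lra).
  assert (enorm N <> 0) by nra.
  rewrite <- HnN; field; assumption.
Qed.

(** * Rigidity *)

(** These are the derivatives of the two unit norm conditions and of the
    orthogonality that they imply. *)
Lemma spherical_orthonormal (A : R -> Prop) (beta : R -> R3) :
  open A -> smooth_on A beta ->
  (forall t, A t -> dot (beta t) (beta t) = 1 /\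
     dot (velocity beta t) (velocity beta t) = 1) ->
  forall t, A t ->
    dot (beta t) (velocity beta t) = 0 /\
    dot (beta t) (velocity (velocity beta) t) = -1 /\
    dot (velocity beta t) (velocity (velocity beta) t) = 0.
Proof.
  intros HA Hb Hon.
  assert (V : forall t, A t -> is_velocity beta t (velocity beta t))
    by (intros; now apply (smooth_is_velocity A)).
  assert (V2 : forall t, A t ->
      is_velocity (velocity beta) t (velocity (velocity beta) t))
    by (intros; apply (smooth_is_velocity A); auto using smooth_velocity).
  assert (H1 : forall t, A t -> dot (beta t) (velocity beta t) = 0).
  { intros t Ht.
    assert (E := derive_constant_on A _ 1 t _ HA (fun s Hs => proj1 (Hon s Hs)) Ht
      (is_derive_dot _ _ _ _ _ (V t Ht) (V t Ht))).
    rewrite (dot_comm (velocity beta t)) in E; lra. }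
  intros t Ht; split; [auto|split].
  - assert (E := derive_constant_on A _ 0 t _ HA H1 Ht
      (is_derive_dot _ _ _ _ _ (V t Ht) (V2 t Ht))).
    rewrite (proj2 (Hon t Ht)) in E; lra.
  - assert (E := derive_constant_on A _ 1 t _ HA (fun s Hs => proj2 (Hon s Hs)) Ht
      (is_derive_dot _ _ _ _ _ (V2 t Ht) (V2 t Ht))).
    rewrite (dot_comm (velocity (velocity beta) t)) in E; lra.
Qed.

(** This formula is what makes [l] differentiable. *)
Lemma distribution_parameter_eq (A : R -> Prop) (alpha beta : R -> R3)
    (l : R -> R) (t : R) :
  distribution_parameter A alpha beta l -> A t ->
  dot (velocity beta t) (velocity beta t) = 1 ->
  dot (cross (velocity alpha t) (beta t)) (velocity beta t) = l t.
Proof.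
  intros Hl Ht H; rewrite (Hl t Ht), dot_scal, H; ring.
Qed.

Lemma distribution_parameter_regularity (A : R -> Prop) (alpha beta : R -> R3)
    (l : R -> R) :
  open A -> smooth_on A alpha -> smooth_on A beta ->
  (forall t, A t -> dot (velocity beta t) (velocity beta t) = 1) ->
  distribution_parameter A alpha beta l ->
  exists l1 l2 : R -> R, forall t, A t ->
    is_derive l t (l1 t) /\ is_derive l1 t (l2 t).
Proof.
  intros HA Ha Hb H1 Hl.
  assert (Ha1 := smooth_velocity A alpha Ha).
  assert (Ha2 := smooth_velocity A _ Ha1).
  assert (Hb1 := smooth_velocity A beta Hb).
  assert (Hb2 := smooth_velocity A _ Hb1).
  assert (V : forall c t, smooth_on A c -> A t -> is_velocity c t (velocity c t))
    by (intros; now apply (smooth_is_velocity A)).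
  set (a1 := velocity alpha) in *; set (a2 := velocity a1) in *.
  set (b1 := velocity beta) in *; set (b2 := velocity b1) in *.
  set (p := fun s => plus (cross (a2 s) (beta s)) (cross (a1 s) (b1 s))).
  exists (fun s => dot (p s) (b1 s) + dot (cross (a1 s) (beta s)) (b2 s)).
  eexists (fun t => _); intros t Ht; split.
  - apply (is_derive_ext_on A (fun s => dot (cross (a1 s) (beta s)) (b1 s))); auto.
    + intros s Hs; apply (distribution_parameter_eq A alpha beta l); auto.
    + apply is_derive_dot; [apply is_velocity_cross|]; apply V; auto.
  - apply (is_derive_plus_R (fun s => dot (p s) (b1 s))
      (fun s => dot (cross (a1 s) (beta s)) (b2 s))); apply is_derive_dot.
    + apply is_velocity_plus; apply is_velocity_cross; apply V; auto.
    + apply V; auto.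
    + apply is_velocity_cross; apply V; auto.
    + apply V; auto.
Qed.

(** Where [l] does not vanish, [ricci_coefficients] gives [l' = 0] and [m = 0].
    Passing to [l ^ 2] avoids a connectedness argument: its derivative
    [2 l l'] also vanishes at the zeros of [l], whatever [l'] is there. *)
Lemma ricci_ruled_rigidity (I J : R -> Prop) (alpha beta : R -> R3) (l : R -> R) :
  open_interval I -> open_interval J ->
  smooth_on I alpha -> smooth_on I beta ->
  (forall t, I t -> dot (beta t) (beta t) = 1 /\
     dot (velocity beta t) (velocity beta t) = 1 /\
     dot (velocity alpha t) (velocity beta t) = 0) ->
  distribution_parameter I alpha beta l -> (exists t, I t /\ l t <> 0) ->
  ricci_condition (ruled alpha beta) I J ->
  exists a, a <> 0 /\ forall t, I t ->
    l t = a /\ dot (velocity alpha t) (beta t) = 0.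
Proof.
  intros HI HJ Ha Hb Hon Hl (t0 & Ht0 & Hl0) Hric.
  assert (OI := open_interval_open I HI); assert (OJ := open_interval_open J HJ).
  assert (Hon' := spherical_orthonormal I beta OI Hb
    (fun t Ht => conj (proj1 (Hon t Ht)) (proj1 (proj2 (Hon t Ht))))).
  destruct (distribution_parameter_regularity I alpha beta l OI Ha Hb
    (fun t Ht => proj1 (proj2 (Hon t Ht))) Hl) as (l1 & l2 & Hd).
  set (m := fun t => dot (velocity alpha t) (beta t)).
  set (A := fun t => I t /\ l t <> 0).
  (* At a zero of [l] the curvature and its differential vanish, so the Ricci
     condition says nothing there: it is used on the open set [A] only. *)
  assert (OA : open A).
  { intros t (Ht & Hlt); apply filter_and; [exact (OI t Ht)|].
    assert (C : continuous l t)
      by (apply (ex_derive_continuous (V := R_NormedModule)); eexists; apply (Hd t Ht)).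
    exact (C _ (open_neq 0 (l t) Hlt)). }
  assert (HX : has_striction_metric (ruled alpha beta) A J l m).
  { apply ruled_striction_metric.
    - intros n t [Ht _]; now apply Ha.
    - intros n t [Ht _]; now apply Hb.
    - intros t [Ht _]; destruct (Hon t Ht) as (? & ? & ?).
      destruct (Hon' t Ht); auto.
    - intros t [Ht _]; now apply Hl.
    - now intros t [_ Ht]. }
  assert (Key : forall t, A t -> l1 t = 0 /\ m t = 0).
  { intros t HAt; assert (Ht := proj1 HAt); assert (Hlt := proj2 HAt).
    assert (Hm : exists m1, is_derive m t m1).
    { eexists; apply is_derive_dot; apply (smooth_is_velocity I);
        auto using smooth_velocity. }
    destruct Hm as [m1 Hm].
    destruct (quartic_zero_on J (l t * l2 t - l1 t ^ 2)
      (2 * l t ^ 2 * m1 + l t * l1 t * m t)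
      (l t ^ 2 * (4 * m t ^ 2 - 5 * l1 t ^ 2))
      (2 * l t ^ 4 * m1 - 11 * l t ^ 3 * l1 t * m t)
      (l t ^ 4 * (2 * l1 t ^ 2 - 2 * m t ^ 2 - l t * l2 t)) OJ
      (open_interval_inhabited J HJ)) as (_ & H3 & H2 & H1 & _).
    - intros u Hu; specialize (Hric t u Ht Hu).
      rewrite (ricci_expression _ A J l l1 m t u (l2 t) m1 OA OJ HX) in Hric;
        try assumption.
      + assert (Hpos : 0 < l t ^ 2) by (simpl; nra).
        apply Rmult_integral in Hric as [Hric|Hric]; [exfalso|exact Hric].
        revert Hric; apply Rgt_not_eq, Rdiv_lt_0_compat; [lra|].
        apply pow_lt; simpl; nra.
      + now intros s [_ Hs].
      + intros s [Hs _]; apply (Hd s Hs).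
      + apply (Hd t Ht).
    - apply (ricci_coefficients (l t) (l1 t) (m t) m1); assumption. }
  assert (Hsq : forall t, I t -> l t * l t = l t0 * l t0).
  { intros t Ht; apply (constant_of_derive_zero I (fun s => l s * l s)); auto.
    intros s Hs; destruct (Hd s Hs) as [Hls _].
    apply (is_derive_eq _ _ _ _ (is_derive_mult_R _ _ _ _ _ Hls Hls)).
    destruct (Req_dec (l s) 0) as [E|E].
    - rewrite E; ring.
    - rewrite (proj1 (Key s (conj Hs E))); ring. }
  assert (HA : forall t, I t -> A t).
  { intros t Ht; split; [exact Ht|]; intros E; specialize (Hsq t Ht).
    rewrite E in Hsq; nra. }
  exists (l t0); split; [exact Hl0|]; intros t Ht; split.
  - apply (constant_of_derive_zero I l); auto; intros s Hs.
    destruct (Hd s Hs) as [Hls _]; now rewrite (proj1 (Key s (HA s Hs))) in Hls.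
  - apply (Key t (HA t Ht)).
Qed.

(** * The helicoid *)

(** A curve [beta] on the sphere with unit speed satisfies
    [beta'' = - beta + k cross beta beta'], with [k] its geodesic curvature;
    the line forces [k = 0]. *)
Lemma director_great_circle (I : R -> Prop) (alpha beta : R -> R3) (a : R) :
  open I -> smooth_on I alpha -> smooth_on I beta ->
  (forall t, I t -> dot (beta t) (beta t) = 1 /\
     dot (velocity beta t) (velocity beta t) = 1) ->
  a <> 0 ->
  (forall t, I t ->
     velocity alpha t = scal a (cross (beta t) (velocity beta t))) ->
  contained_in_line I alpha ->
  forall t, I t -> velocity (velocity beta) t = scal (-1) (beta t).
Proof.
  intros HI Ha Hb Hon Ha0 Hv (p & v & Hv0 & Hline).
  assert (Hon' := spherical_orthonormal I beta HI Hb Hon).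
  assert (V : forall c t, smooth_on I c -> I t -> is_velocity c t (velocity c t))
    by (intros; now apply (smooth_is_velocity I)).
  assert (Hb1 := smooth_velocity I beta Hb).
  (* The moment [cross (alpha t) v] is constant on a line of direction [v]. *)
  assert (Hpar : forall t, I t -> cross (velocity alpha t) v = mk3 0 0 0).
  { intros t Ht.
    assert (E : plus (cross (velocity alpha t) v) (cross (alpha t) (mk3 0 0 0))
      = mk3 0 0 0).
    { apply (velocity_constant_on I (fun s => cross (alpha s) v) (cross p v) t); auto.
      - intros s Hs; destruct (Hline s Hs) as [r ->]; vector_ring.
      - apply is_velocity_cross; [now apply V | apply is_velocity_const]. }
    rewrite <- E; vector_ring. }
  (* The product [cross (cross b c) v] expands to
     [<b, v> c - <c, v> b], with [b] and [c] independent. *)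
  assert (Horth : forall t, I t ->
      dot v (beta t) = 0 /\ dot v (velocity beta t) = 0).
  { intros t Ht; specialize (Hpar t Ht); rewrite (Hv t Ht) in Hpar.
    destruct (Hon t Ht) as [Hbb Hcc]; destruct (Hon' t Ht) as [Hbc _].
    revert Hpar Hbb Hcc Hbc; generalize (beta t) (velocity beta t); intros b c.
    intros Hpar Hbb Hcc Hbc.
    assert (E : forall w, a * (dot b v * dot c w - dot c v * dot b w) = 0).
    { intros w; transitivity (dot (cross (scal a (cross b c)) v) w); [vector_ring|].
      rewrite Hpar; vector_ring. }
    assert (Ec := E c); assert (Eb := E b).
    rewrite Hcc, Hbc in Ec; rewrite (dot_comm c b), Hbc, Hbb in Eb.
    rewrite !(dot_comm v).
    apply Rmult_integral in Ec as [Ec|Ec]; [easy|].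
    apply Rmult_integral in Eb as [Eb|Eb]; [easy|]; split; lra. }
  intros t Ht.
  destruct (Hon t Ht) as [Hbb Hcc], (Hon' t Ht) as (Hbc & Hbd & Hcd).
  destruct (Horth t Ht) as [Hvb Hvc].
  assert (Hvd : dot v (velocity (velocity beta) t) = 0).
  { assert (E := derive_constant_on I _ 0 t _ HI (fun s Hs => proj2 (Horth s Hs)) Ht
      (is_derive_dot _ _ _ _ _ (is_velocity_const v t) (V _ t Hb1 Ht))).
    rewrite <- E; vector_ring. }
  revert Hbb Hcc Hbc Hbd Hcd Hvb Hvc Hvd.
  generalize (beta t) (velocity beta t) (velocity (velocity beta) t).
  intros b c d Hbb Hcc Hbc Hbd Hcd Hvb Hvc Hvd.
  (* [d + b] and [v] are both multiples of the normal [cross b c], and they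
     are orthogonal to each other. *)
  assert (Ew := orthogonal_to_plane b c (plus d b) Hbb Hcc Hbc).
  rewrite !dot_plus, (dot_comm d b), (dot_comm d c), Hbd, Hcd, Hbb, Hbc in Ew.
  specialize (Ew ltac:(lra) ltac:(lra)).
  assert (Ev := orthogonal_to_plane b c v Hbb Hcc Hbc Hvb Hvc).
  assert (Hvn : dot v (cross b c) <> 0).
  { intros E; apply Hv0; rewrite Ev, E; exact (scal_zero_l (cross b c)). }
  assert (Hw : dot (plus d b) v = 0)
    by (rewrite dot_plus, !(dot_comm _ v), Hvb, Hvd; ring).
  rewrite Ew, dot_scal, <- dot_plus, (dot_comm _ v) in Hw.
  apply Rmult_integral in Hw as [Hw|Hw]; [|easy].
  rewrite <- dot_plus, Hw in Ew.
  transitivity (plus (plus d b) (scal (-1) b)); [vector_ring|].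
  rewrite Ew; vector_ring.
Qed.

Definition frame_map (q e1 e2 e3 p : R3) : R3 :=
  plus q (plus (scal (cx p) e1) (plus (scal (cy p) e2) (scal (cz p) e3))).

Lemma isometry_frame_map (q e1 e2 e3 : R3) :
  dot e1 e1 = 1 -> dot e2 e2 = 1 -> dot e3 e3 = 1 ->
  dot e1 e2 = 0 -> dot e1 e3 = 0 -> dot e2 e3 = 0 ->
  isometry (frame_map q e1 e2 e3).
Proof.
  intros H11 H22 H33 H12 H13 H23 p p'; unfold enorm; f_equal.
  set (x := cx p - cx p'); set (y := cy p - cy p'); set (z := cz p - cz p').
  transitivity (x ^ 2 * dot e1 e1 + y ^ 2 * dot e2 e2 + z ^ 2 * dot e3 e3
    + 2 * (x * y * dot e1 e2 + x * z * dot e1 e3 + y * z * dot e2 e3)).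
  - unfold x, y, z, frame_map; vector_ring.
  - rewrite H11, H22, H33, H12, H13, H23; unfold x, y, z, dot; rewrite minus_R3.
    cbn -[Rmult Rplus Rminus pow]; unfold cx, cy, cz; cbn -[Rmult Rplus Rminus pow]; ring.
Qed.

(** Solves [beta'' = - beta]: rotating the pair [(beta, beta')] backwards by
    the angle [s] gives two vectors that do not depend on [s]. *)
Lemma great_circle_param (I : R -> Prop) (beta : R -> R3) (t0 t : R) :
  open_interval I -> smooth_on I beta ->
  (forall s, I s -> velocity (velocity beta) s = scal (-1) (beta s)) ->
  I t0 -> I t ->
  let c := velocity beta in
  beta t = plus (scal (cos t) (plus (scal (cos t0) (beta t0)) (scal (- sin t0) (c t0))))
                (scal (sin t) (plus (scal (sin t0) (beta t0)) (scal (cos t0) (c t0)))).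
Proof.
  intros HI Hb Hode Ht0 Ht c.
  assert (V : forall s, I s -> is_velocity beta s (c s))
    by (intros; now apply (smooth_is_velocity I)).
  assert (V' : forall s, I s -> is_velocity c s (scal (-1) (beta s))).
  { intros s Hs; rewrite <- Hode by exact Hs.
    apply (smooth_is_velocity I); auto using smooth_velocity. }
  assert (Ds : forall s, is_derive sin s (cos s))
    by (intros; auto_derive; [easy | ring]).
  assert (Dc : forall s, is_derive cos s (- sin s))
    by (intros; auto_derive; [easy | ring]).
  assert (Dn : forall s, is_derive (fun r => - sin r) s (- cos s))
    by (intros; auto_derive; [easy | ring]).
  rewrite <- (constant_of_velocity_zero I
    (fun s => plus (scal (cos s) (beta s)) (scal (- sin s) (c s))) t t0 HI); auto.
  2:{ intros s Hs; eapply is_velocity_eq.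
      - apply (is_velocity_combination cos (fun r => - sin r)); auto.
      - cbv beta; generalize (beta s) (c s) (cos s) (sin s); vector_ring. }
  rewrite <- (constant_of_velocity_zero I
    (fun s => plus (scal (sin s) (beta s)) (scal (cos s) (c s))) t t0 HI); auto.
  2:{ intros s Hs; eapply is_velocity_eq.
      - apply (is_velocity_combination sin cos); auto.
      - cbv beta; generalize (beta s) (c s) (cos s) (sin s); vector_ring. }
  transitivity (scal (Rsqr (sin t) + Rsqr (cos t)) (beta t)).
  - rewrite sin2_cos2; generalize (beta t); vector_ring.
  - unfold Rsqr; generalize (beta t) (c t) (cos t) (sin t); vector_ring.
Qed.

Lemma piece_of_helicoid_of_great_circle (I J : R -> Prop) (alpha beta : R -> R3) (a : R)
   (Sigma : R3 -> Prop) :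
  open_interval I -> open_interval J -> smooth_on I alpha -> smooth_on I beta ->
  (forall t, I t -> dot (beta t) (beta t) = 1 /\
     dot (velocity beta t) (velocity beta t) = 1) ->
  a <> 0 ->
  (forall t, I t ->
     velocity alpha t = scal a (cross (beta t) (velocity beta t))) ->
  (forall t, I t -> velocity (velocity beta) t = scal (-1) (beta t)) ->
  parametrized_by Sigma I J (ruled alpha beta) ->
  piece_of_helicoid Sigma.
Proof.
  intros HI HJ Ha Hb Hon Ha0 Hv Hode HS.
  destruct (open_interval_inhabited I HI) as [t0 Ht0].
  set (c := velocity beta) in *.
  assert (V : forall s, I s -> is_velocity beta s (c s))
    by (intros; now apply (smooth_is_velocity I)).
  assert (V' : forall s, I s -> is_velocity c s (scal (-1) (beta s))).
  { intros s Hs; rewrite <- Hode by exact Hs.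
    apply (smooth_is_velocity I); auto; now apply smooth_velocity. }
  set (n := fun s => cross (beta s) (c s)).
  assert (Hn : forall t, I t -> n t = n t0).
  { intros t Ht; apply (constant_of_velocity_zero I n); auto.
    intros s Hs; eapply is_velocity_eq; [apply is_velocity_cross; auto|].
    generalize (beta s) (c s); vector_ring. }
  set (q := plus (scal 1 (alpha t0)) (scal (- a * t0) (n t0))).
  assert (Hq : forall t, I t -> alpha t = plus q (scal (a * t) (n t0))).
  { intros t Ht; unfold q.
    rewrite <- (constant_of_velocity_zero I
      (fun s => plus (scal 1 (alpha s)) (scal (- a * s) (n t0))) t t0 HI); auto.
    - generalize (alpha t) (n t0); vector_ring.
    - intros s Hs; eapply is_velocity_eq.
      + apply (is_velocity_combination (fun _ => 1) (fun s => - a * s) alpha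
          (fun _ => n t0) s 0 (- a)).
        * apply @is_derive_const.
        * auto_derive; [easy | ring].
        * now apply (smooth_is_velocity I).
        * apply is_velocity_const.
      + rewrite Hv by exact Hs; fold (n s); rewrite (Hn s Hs).
        generalize (alpha s) (n t0); vector_ring. }
  destruct (Hon t0 Ht0) as [Hbb Hcc].
  assert (Hbc : dot (beta t0) (c t0) = 0)
    by now apply (spherical_orthonormal I beta (open_interval_open I HI)).
  set (e1 := plus (scal (cos t0) (beta t0)) (scal (- sin t0) (c t0))).
  set (e2 := plus (scal (sin t0) (beta t0)) (scal (cos t0) (c t0))).
  assert (Hcs := sin2_cos2 t0); unfold Rsqr in Hcs.
  (* Rotating the frame at [t0] back by the angle [t0] makes the angle of the
     helicoid equal to [t], so [I] itself serves as its parameter interval. *)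
  exists (frame_map q e1 e2 (n t0)), a, 0, I, J.
  split; [apply isometry_frame_map|split; [exact Ha0|split; [exact HI|split; [exact HJ|]]]].
  - rewrite <- Hcs; unfold e1.
    rewrite dot_combination, !(dot_comm _ (plus _ _)), !dot_combination,
      (dot_comm (c t0) (beta t0)), Hbb, Hcc, Hbc; ring.
  - rewrite <- Hcs; unfold e2.
    rewrite dot_combination, !(dot_comm _ (plus _ _)), !dot_combination,
      (dot_comm (c t0) (beta t0)), Hbb, Hcc, Hbc; ring.
  - unfold n; rewrite dot_cross_cross, Hbb, Hcc, Hbc; ring.
  - unfold e1, e2.
    rewrite dot_combination, !(dot_comm _ (plus _ _)), !dot_combination,
      (dot_comm (c t0) (beta t0)), Hbb, Hcc, Hbc; ring.
  - unfold e1, n; generalize (beta t0) (c t0) (cos t0) (sin t0); vector_ring.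
  - unfold e2, n; generalize (beta t0) (c t0) (cos t0) (sin t0); vector_ring.
  - assert (E : forall t u, I t ->
      ruled alpha beta t u = frame_map q e1 e2 (n t0) (helicoid a 0 t u)).
    { intros t u Ht; unfold ruled, frame_map, helicoid.
      rewrite (Hq t Ht), (great_circle_param I beta t0 t HI Hb Hode Ht0 Ht).
      fold c e1 e2; generalize q e1 e2 (n t0) (cos t) (sin t); vector_ring. }
    intros p; rewrite (HS p); split; intros (t & u & Ht & Hu & ->);
      exists t, u; repeat split; auto; now rewrite E.
Qed.

Theorem theorem1 :
  forall (Sigma : R3 -> Prop) (I J : R -> Prop) (alpha beta : R -> R3),
    ruled_parametrization I J alpha beta ->
    parametrized_by Sigma I J (ruled alpha beta) ->
    non_developable I alpha beta ->
    ricci_condition (ruled alpha beta) I J ->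
    contained_in_line I alpha ->
    piece_of_helicoid Sigma.
Proof.
  intros Sigma I J alpha beta (HI & HJ & Ha & Hb & Hnorm & _) HS
    (l & Hl & Hl0) Hric Hline.
  assert (Hon : forall t, I t -> dot (beta t) (beta t) = 1 /\
     dot (velocity beta t) (velocity beta t) = 1).
  { intros t Ht; destruct (Hnorm t Ht) as (H1 & H2 & _).
    split; now apply enorm_eq_1. }
  destruct (ricci_ruled_rigidity I J alpha beta l) as (a & Ha0 & Hrig); auto.
  { intros t Ht; destruct (Hon t Ht); destruct (Hnorm t Ht) as (_ & _ & ?); auto. }
  assert (Hv : forall t, I t ->
     velocity alpha t = scal a (cross (beta t) (velocity beta t))).
  { intros t Ht; destruct (Hrig t Ht) as [Hla Hab]; specialize (Hl t Ht).
    assert (E := cross_cross (beta t) (velocity alpha t) (beta t)).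
    rewrite (proj1 (Hon t Ht)), (dot_comm _ (velocity alpha t)), Hab, Hl, Hla in E.
    transitivity (minus (scal 1 (velocity alpha t)) (scal 0 (beta t)));
      [generalize (velocity alpha t) (beta t); vector_ring|].
    rewrite <- E; generalize (beta t) (velocity beta t); vector_ring. }
  apply (piece_of_helicoid_of_great_circle I J alpha beta a); auto.
  apply (director_great_circle I alpha beta a); auto using open_interval_open.
Qed.
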